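(* Assume that Hypothesis H (stated in the context) holds for all integers $n \ge 1$ and all $\varepsilon \in (0,1/2)$. Then for every $\varepsilon \in (0, 1/2)$ there exists a constant $d = d(\varepsilon)$, depending only on $\varepsilon$ and not on the dimension, such that for every integer $n \ge 1$ the following holds. If $K_n \subset \mathbb{R}^n$ is an $n$-dimensional cube of unit volume and $A, B \subseteq K_n$ are convex subsets, each of $n$-dimensional volume $\varepsilon$, then $\mathrm{dist}(A, B) \le d$.
   Context: For sets $A, B \subset \mathbb{R}^n$, $\mathrm{dist}(A,B) = \inf_{X \in A,\, Y \in B} \mathrm{dist}(X,Y)$, where $\mathrm{dist}(X,Y)$ is the Euclidean distance between the points $X$ and $Y$. Volume means $n$-dimensional Lebesgue measure. Definition of the function $f$. Fix $n \ge 1$ and $\varepsilon \in (0,1/2)$, and place the cube as $K_n = [0,1]^n$, so that all coordinates of its vertices are $0$ or $1$. For a unit vector $\vec{n} = (n_1,\ldots,n_n) \in \mathbb{R}^n$ there are unique real numbers $a < b$ such that the sets $A_{\vec{n}} = \{x \in K_n : \langle x, \vec{n}\rangle \le a\}$ and $B_{\vec{n}} = \{x \in K_n : \langle x, \vec{n}\rangle \ge b\}$ both have volume exactly $\varepsilon$. Put $f(\vec{n}) = f_{n,\varepsilon}(\vec{n}) = \mathrm{dist}(A_{\vec{n}}, B_{\vec{n}})$. By the symmetry of the cube, $f$ is considered only on the set of unit vectors $\vec{n}$ with all coordinates nonnegative. Hypothesis H (for given $n$ and $\varepsilon$): at any point $\vec{n}$ (a unit vector with nonnegative coordinates) where $f_{n,\varepsilon}$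 attains its global maximum, all nonzero coordinates of $\vec{n}$ are equal to each other. *)

(* Defs.v *)
From HB Require Import structures.
From mathcomp Require Import all_boot all_order all_algebra.
From mathcomp Require Import all_classical all_reals all_analysis.

Set Implicit Arguments.
Unset Strict Implicit.
Unset Printing Implicit Defensive.

Import Order.TTheory GRing.Theory Num.Theory.
Import numFieldNormedType.Exports.

Local Open Scope classical_set_scope.
Local Open Scope ring_scope.

(* Points of R^n are row vectors 'rV[R]_n; the norm that the library puts on
   'rV[R]_n is the sup norm, so the Euclidean one is defined here. *)

Definition dotp (R : realType) (n : nat) (x y : 'rV[R]_n) : R :=
  \sum_(i < n) x ord0 i * y ord0 i.

Definition enorm (R : realType) (n : nat) (x : 'rV[R]_n) : R :=
  Num.sqrt (dotp x x).

(* [inf] is the real infimum, which is meaningful for nonempty A and B; it is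
   only applied to sets of positive volume. *)
Definition set_dist (R : realType) (n : nat) (A B : set 'rV[R]_n) : R :=
  inf [set enorm (x - y) | x in A & y in B].

(* The n-fold product of the one-dimensional Lebesgue measure, on the product
   sigma-algebra of n.-tuple R; its values outside that sigma-algebra are not
   meaningful. *)
Fixpoint lebesgue_tuple (R : realType) (n : nat) :
    set (n.-tuple (measurableTypeR R)) -> \bar R :=
  match n with
  | 0%N => \d_ [tuple]
  | m.+1 => pushforward (lebesgue_measure \x @lebesgue_tuple R m)%E
              (fun p => cons_tuple p.1 p.2)
  end.

Definition tuple_of_row (R : realType) (n : nat) (x : 'rV[R]_n) :
    n.-tuple (measurableTypeR R) := [tuple x ord0 i | i < n].

(* n-dimensional Lebesgue measure. Convex sets are Lebesgue measurable but need
   not be Borel, so the product measure is extended to all sets by its outer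
   measure, which agrees with Lebesgue measure on Lebesgue measurable sets. *)
Definition volume (R : realType) (n : nat) (A : set 'rV[R]_n) : \bar R :=
  mu_ext (@lebesgue_tuple R n) (@tuple_of_row R n @` A).

Definition unit_cube (R : realType) (n : nat) : set 'rV[R]_n :=
  [set x | forall i, 0 <= x ord0 i <= 1].
Arguments unit_cube : clear implicits.

(* A cube in arbitrary position: a positive multiple of [0,1]^n, moved by an
   orthogonal map (acting on row vectors from the right) and a translation. *)
Definition is_cube (R : realType) (n : nat) (K : set 'rV[R]_n) : Prop :=
  exists (c : 'rV[R]_n) (s : R) (Q : 'M[R]_n),
    [/\ 0 < s, Q *m Q^T = 1%:M &
        K = [set c + s *: (x *m Q) | x in unit_cube R n]].

Definition lower_cap (R : realType) (n : nat) (v : 'rV[R]_n) (a : R) :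
    set 'rV[R]_n := [set x | unit_cube R n x /\ dotp x v <= a].

Definition upper_cap (R : realType) (n : nat) (v : 'rV[R]_n) (b : R) :
    set 'rV[R]_n := [set x | unit_cube R n x /\ b <= dotp x v].

(* The pair (a, b) that cuts off caps of volume eps orthogonally to v; the
   default (0, 0) is never used when v is a unit vector and 0 < eps < 1/2. *)
Definition cuts (R : realType) (n : nat) (eps : R) (v : 'rV[R]_n) : R * R :=
  xget (0, 0) [set p : R * R |
    [/\ p.1 < p.2, volume (lower_cap v p.1) = eps%:E
      & volume (upper_cap v p.2) = eps%:E]].

Definition cap_dist (R : realType) (n : nat) (eps : R) (v : 'rV[R]_n) : R :=
  set_dist (lower_cap v (cuts eps v).1) (upper_cap v (cuts eps v).2).

Definition nonneg_unit (R : realType) (n : nat) : set 'rV[R]_n :=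
  [set v | enorm v = 1 /\ forall i, 0 <= v ord0 i].
Arguments nonneg_unit : clear implicits.

Definition max_coords_equal (R : realType) (n : nat) (eps : R) : Prop :=
  forall v : 'rV[R]_n, nonneg_unit R n v ->
    (forall w : 'rV[R]_n, nonneg_unit R n w ->
       cap_dist eps w <= cap_dist eps v) ->
    forall i j : 'I_n, v ord0 i != 0 -> v ord0 j != 0 -> v ord0 i = v ord0 j.

(* Main.v *)
Require Import Defs.
From HB Require Import structures.
From mathcomp Require Import all_boot all_order all_algebra.
From mathcomp Require Import all_classical all_reals all_analysis.
From mathcomp Require Import ring lra.
Import Order.TTheory GRing.Theory Num.Theory.
Import numFieldNormedType.Exports.
Local Open Scope classical_set_scope.
Local Open Scope ring_scope.

Set Implicit Arguments.
Unset Strict Implicit.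
Unset Printing Implicit Defensive.

(** If [m] is the infimum of the squared distances between [A] and [B] and
    [w = a - b] nearly attains it, convexity gives [<w, x - y> >= m / 2] for all
    [x] in [A] and [y] in [B], while [|w|^2 <= 2 m].  For a uniform point of the
    cube the variance of [<w, x>] is [|w|^2 / 12] in every dimension, and one of
    [A], [B] lies where [<w, x>] deviates from its mean by at least [m / 4]; so
    Chebyshev's inequality bounds [m] by a multiple of [1 / eps].

    The variance is computed on a grid of cells of side [1 / N], at least
    [eps N^n] of which meet [A] because each has volume at most [N^-n].  In a
    rotated cube this bound on the cells needs only translation invariance and
    [vol K = 1].  The side [s] of [K] is at most 1, since counting cells gives
    [vol (ball (s r)) <= vol (ball (r + e))] for all [r, e > 0]. *)

(** * The product measure on tuples *)

Definition tuple_split (R : realType) (n : nat)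
    (t : n.+1.-tuple (measurableTypeR R)) :
    measurableTypeR R * n.-tuple (measurableTypeR R) :=
  (thead t, [tuple of behead t]).

Definition tuple_join (R : realType) (n : nat)
    (p : measurableTypeR R * n.-tuple (measurableTypeR R)) :
    n.+1.-tuple (measurableTypeR R) := cons_tuple p.1 p.2.

Lemma tuple_joinK (R : realType) (n : nat) :
  cancel (@tuple_join R n) (@tuple_split R n).
Proof.
by move=> [x t]; congr pair; exact/val_inj.
Qed.

Lemma measurable_tuple_split (R : realType) (n : nat) :
  measurable_fun setT (@tuple_split R n).
Proof.
apply: measurable_fun_pair; last exact: measurable_behead.
exact: measurable_tnth.
Qed.

Lemma measurable_tuple_join (R : realType) (n : nat) :
  measurable_fun setT (@tuple_join R n).
Proof. exact: measurable_cons. Qed.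

(** Sigma-finiteness is carried through the induction on [n] because the product with
    [lebesgue_measure] is a measure, determined by its values on rectangles, when the factors are
    sigma-finite. *)
Lemma lebesgue_tuple_sigma_finite_measure (R : realType) (n : nat) :
  exists mu : {sigma_finite_measure set (n.-tuple (measurableTypeR R)) -> \bar R},
    mu = @lebesgue_tuple R n :> (set _ -> \bar R).
Proof.
elim: n => [|n [mu muE]].
  by exists (\d_ ([tuple] : 0.-tuple (measurableTypeR R))).
have mj := @measurable_tuple_join R n.
pose nu : {measure set _ -> \bar R} :=
  measure_function_pushforward__canonical__measure_function_Measure
    (lebesgue_measure \x mu)%E mj.
have nu_fin : sigma_finite setT nu.
  have /sigma_finiteP[F [FT ndF Foo]] :=
    sigma_finiteT (lebesgue_measure : {sigma_finite_measure set (measurableTypeR R) -> \bar R}).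
  have /sigma_finiteP[G [GT ndG Goo]] := sigma_finiteT mu.
  have mFG k : measurable (F k `*` G k).
    by apply: measurableX; [have [] := Foo k|have [] := Goo k].
  exists (fun k => @tuple_split R n @^-1` (F k `*` G k)).
    rewrite -preimage_bigcup -(preimage_setT (@tuple_split R n)).
    congr (_ @^-1` _); apply/esym; rewrite -subTset => -[x y] _.
    have [i _ Fi] : (\bigcup_k F k) x by rewrite -FT.
    have [j _ Gj] : (\bigcup_k G k) y by rewrite -GT.
    (* Both exhausting sequences are nondecreasing, so the larger index serves both coordinates. *)
    exists (maxn i j) => //; split => /=.
    - by move: x Fi; exact/subsetPset/ndF/leq_maxl.
    - by move: y Gj; exact/subsetPset/ndG/leq_maxr.
  move=> k; split.
    by rewrite -[X in measurable X]setTI; exact: measurable_tuple_split.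
  rewrite /= /pushforward -comp_preimage (_ : _ \o _ = id); last first.
    by apply/funext => p; exact: tuple_joinK.
  have [mF Fk] := Foo k; have [mG Gk] := Goo k.
  by rewrite [ltLHS]product_measure1E// lte_mul_pinfty// ge0_fin_numE.
pose fnu := Measure_isSigmaFinite.Build _ _ _ (nu : set _ -> \bar R) nu_fin.
pose nuS : {sigma_finite_measure set (n.+1.-tuple (measurableTypeR R)) -> \bar R} :=
  HB.pack (nu : set _ -> \bar R) (Measure.class nu) fnu.
by exists nuS; rewrite /= muE.
Qed.

Definition lebesgue_tuple_measure (R : realType) (n : nat) :
    {sigma_finite_measure set (n.-tuple (measurableTypeR R)) -> \bar R} :=
  sval (cid (lebesgue_tuple_sigma_finite_measure R n)).

Lemma lebesgue_tuple_measureE (R : realType) (n : nat) :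
  lebesgue_tuple_measure R n = @lebesgue_tuple R n :> (set _ -> \bar R).
Proof. by rewrite /lebesgue_tuple_measure; case: cid. Qed.

Lemma lebesgue_tuple_measureS (R : realType) (n : nat) A :
  lebesgue_tuple_measure R n.+1 A =
  (lebesgue_measure \x lebesgue_tuple_measure R n)%E (@tuple_join R n @^-1` A).
Proof. by rewrite !lebesgue_tuple_measureE. Qed.

Lemma measurable_translate (R : realType) (a : R) :
  measurable_fun setT (fun x : measurableTypeR R => a + x : measurableTypeR R).
Proof. exact: (@measurable_realfun.measurable_funD _ _ _ _ (cst a) id). Qed.

(** The image of Lebesgue measure under a translation gives half-open intervals their length, and
    this characterises Lebesgue measure. *)
Lemma lebesgue_measure_translate (R : realType) (a : R)
    (A : set (measurableTypeR R)) : measurable A ->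
  lebesgue_measure ((fun x : measurableTypeR R => a + x) @^-1` A) =
  lebesgue_measure A.
Proof.
move=> mA.
pose mu : {measure set (measurableTypeR R) -> \bar R} :=
  measure_function_pushforward__canonical__measure_function_Measure
    lebesgue_measure (@measurable_translate R a).
rewrite -[LHS]/(mu A); apply/esym/lebesgue_measure_unique => //.
move=> X /ocitvP[->|[[x y]/= xy ->]]; first by rewrite !measure0.
rewrite /mu/= /pushforward [in RHS](_ : _ @^-1` _ = `]x - a, y - a]%classic).
  by rewrite !lebesgue_measure_itv/= !lte_fin ltrD2r xy -!EFinB; congr EFin; ring.
by apply/seteqP; split=> z /=; rewrite !in_itv/= ltrBlDl lerBrDl.
Qed.

Definition tuple_translate (R : realType) (n : nat) (a : 'rV[R]_n)
    (t : n.-tuple (measurableTypeR R)) : n.-tuple (measurableTypeR R) :=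
  [tuple a ord0 i + tnth t i | i < n].

Lemma measurable_tuple_translate (R : realType) (n : nat) (a : 'rV[R]_n) :
  measurable_fun setT (tuple_translate a).
Proof.
apply/measurable_fun_tnthP => i.
rewrite (_ : _ \o _ = (fun x : measurableTypeR R => a ord0 i + x) \o
                      (fun t => tnth t i)).
  by apply: measurableT_comp; [exact: measurable_translate|exact: measurable_tnth].
by apply/funext => t /=; rewrite tnth_mktuple.
Qed.

(** By induction on [n]: a translation acts on head and tail separately, so the image measure agrees
    with the product measure on rectangles, which determine it. *)
Lemma lebesgue_tuple_translate (R : realType) (n : nat) (a : 'rV[R]_n)
    (A : set (n.-tuple (measurableTypeR R))) : measurable A ->
  lebesgue_tuple_measure R n (tuple_translate a @^-1` A) =
  lebesgue_tuple_measure R n A.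
Proof.
elim: n a A => [|n IH] a A mA.
  congr (lebesgue_tuple_measure R 0 _); apply/seteqP.
  by split => t /=; rewrite (tuple0 t) (tuple0 (tuple_translate _ _)).
rewrite !lebesgue_tuple_measureS.
pose b : 'rV[R]_n := \row_i a ord0 (lift ord0 i).
pose f (p : measurableTypeR R * n.-tuple (measurableTypeR R)) :
    measurableTypeR R * n.-tuple (measurableTypeR R) :=
  (a ord0 ord0 + p.1, tuple_translate b p.2).
have mf : measurable_fun setT f.
  apply: measurable_fun_pair.
    by apply: measurableT_comp; [exact: measurable_translate|].
  by apply: measurableT_comp; [exact: measurable_tuple_translate|].
have jf p : tuple_translate a (tuple_join p) = tuple_join (f p).
  apply/eq_from_tnth => i; rewrite tnth_mktuple.
  have [j ->|->] := unliftP ord0 i; last by rewrite !tnth0.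
  by rewrite !tnthS tnth_mktuple mxE.
have -> : @tuple_join R n @^-1` (tuple_translate a @^-1` A) =
          f @^-1` (@tuple_join R n @^-1` A).
  by apply/seteqP; split=> p; rewrite /preimage /= jf.
have mA' : measurable (@tuple_join R n @^-1` A).
  by rewrite -[X in measurable X]setTI; exact: measurable_tuple_join.
pose mu : {measure set (measurableTypeR R * n.-tuple (measurableTypeR R)) -> \bar R} :=
  measure_function_pushforward__canonical__measure_function_Measure
    (lebesgue_measure \x lebesgue_tuple_measure R n)%E mf.
rewrite -[LHS]/(mu _); apply/esym/product_measure_unique => // X Y mX mY.
rewrite /mu/= /pushforward (_ : f @^-1` (X `*` Y) =
  ((fun x : measurableTypeR R => a ord0 ord0 + x) @^-1` X) `*`
  (tuple_translate b @^-1` Y)) //.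
rewrite [LHS]product_measure1E.
- by rewrite IH// [X in (X * _)%E]lebesgue_measure_translate.
- by rewrite -[X in measurable X]setTI; exact: measurable_translate.
- by rewrite -[X in measurable X]setTI; exact: measurable_tuple_translate.
Qed.

Lemma lebesgue_tuple_box (R : realType) (n : nat) (a : 'rV[R]_n) (h : R) :
  0 < h ->
  lebesgue_tuple_measure R n
    [set t | forall i, a ord0 i <= tnth t i < a ord0 i + h] = (h ^+ n)%:E.
Proof.
move=> h0; elim: n a => [|n IH] a.
  rewrite lebesgue_tuple_measureE /= diracE mem_set//= => -[]//.
pose b : 'rV[R]_n := \row_i a ord0 (lift ord0 i).
have mbox : measurable [set t : n.-tuple (measurableTypeR R) |
    forall i, b ord0 i <= tnth t i < b ord0 i + h].
  rewrite (_ : mkset _ = \bigcap_(i in [set: 'I_n])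
    ((fun t => tnth t i) @^-1` `[b ord0 i, b ord0 i + h[%classic)).
    apply: fin_bigcap_measurable => // i _; rewrite -[X in measurable X]setTI.
    by apply: measurable_tnth.
  by apply/seteqP; split => t /= ht i; have := ht i; rewrite /= in_itv//=; apply.
rewrite lebesgue_tuple_measureS.
rewrite (_ : _ @^-1` _ = `[a ord0 ord0, a ord0 ord0 + h[%classic `*`
  [set t | forall i, b ord0 i <= tnth t i < b ord0 i + h]).
  rewrite [LHS]product_measure1E// IH [X in (X * _)%E]lebesgue_measure_itv/=.
  by rewrite lte_fin ltrDl h0 -EFinB addrC addKr -EFinM exprS.
apply/seteqP; split => -[x t] /=.
  move=> H; split; first by have := H ord0; rewrite in_itv/= tnth0.
  by move=> i; have := H (lift ord0 i); rewrite tnthS mxE.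
move=> [xa ta] i; have [j ->|->] := unliftP ord0 i.
  by have := ta j; rewrite mxE tnthS.
by move: xa; rewrite in_itv/= tnth0.
Qed.

(** * Volume of sets of row vectors *)

Definition row_of_tuple (R : realType) (n : nat)
    (t : n.-tuple (measurableTypeR R)) : 'rV[R]_n := \row_i tnth t i.

Lemma tuple_of_row_image (R : realType) (n : nat) (A : set 'rV[R]_n) :
  @tuple_of_row R n @` A = @row_of_tuple R n @^-1` A.
Proof.
have K : cancel (@tuple_of_row R n) (@row_of_tuple R n).
  by move=> x; apply/rowP => i; rewrite mxE tnth_mktuple.
apply/seteqP; split => [_ [x Ax <-]|t At]; first by rewrite /preimage /= K.
exists (row_of_tuple t) => //.
by apply/eq_from_tnth => i; rewrite tnth_mktuple mxE.
Qed.

(** On these sets the outer measure [volume] coincides with the product measure. *)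
Definition measurable_rows (R : realType) (n : nat) (A : set 'rV[R]_n) : Prop :=
  measurable (@row_of_tuple R n @^-1` A).

Lemma volumeE (R : realType) (n : nat) (A : set 'rV[R]_n) :
  measurable_rows A ->
  volume A = lebesgue_tuple_measure R n (@row_of_tuple R n @^-1` A).
Proof.
move=> mA; rewrite /volume tuple_of_row_image -lebesgue_tuple_measureE.
exact: measurable_mu_extE.
Qed.

Lemma le_volume (R : realType) (n : nat) (A B : set 'rV[R]_n) :
  A `<=` B -> (volume A <= volume B)%E.
Proof.
move=> AB; rewrite /volume -lebesgue_tuple_measureE.
exact/le_mu_ext/image_subset.
Qed.

Lemma volume_translate (R : realType) (n : nat) (a : 'rV[R]_n)
    (A : set 'rV[R]_n) : measurable_rows A ->
  measurable_rows [set y | A (a + y)] /\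
  volume [set y | A (a + y)] = volume A.
Proof.
move=> mA.
have E : @row_of_tuple R n @^-1` [set y | A (a + y)] =
    tuple_translate a @^-1` (@row_of_tuple R n @^-1` A).
  apply/seteqP; split=> t; rewrite /preimage/=; suff -> :
    row_of_tuple (tuple_translate a t) = a + row_of_tuple t by [];
    by apply/rowP => i; rewrite !mxE tnth_mktuple.
have mA' : measurable_rows [set y | A (a + y)].
  rewrite /measurable_rows E -[X in measurable X]setTI.
  exact: measurable_tuple_translate.
by split=> //; rewrite !volumeE// E lebesgue_tuple_translate.
Qed.

(** * Volume bounds by counting the pieces of a covering or a packing *)

Lemma le_measure_cover d (T : measurableType d) (R : realType)
    (mu : {measure set T -> \bar R}) (I : finType) (P : pred I)
    (E : I -> set T) (v : R) (A : set T) :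
  measurable A -> (forall i, P i -> measurable (E i)) ->
  (forall i, P i -> mu (E i) <= v%:E)%E ->
  (forall x, A x -> exists2 i, P i & E i x) ->
  (mu A <= (v *+ #|P|)%:E)%E.
Proof.
move=> mA mE Ev AE.
have mU r : measurable (\big[setU/set0]_(i <- r | P i) E i).
  exact: bigsetU_measurable.
have H r : (mu (\big[setU/set0]_(i <- r | P i) E i) <= (\sum_(i <- r | P i) v)%:E)%E.
  elim: r => [|i r IH]; first by rewrite !big_nil measure0.
  rewrite !big_cons; case: ifPn => // Pi.
  rewrite EFinD (le_trans (measureU2 _ (mE _ Pi) (mU r)))//.
  by rewrite leeD// Ev.
rewrite -sumr_const; apply: le_trans (H _).
apply: le_measure; rewrite ?inE// => x /AE[i Pi Eix].
by rewrite -bigcup_seq_cond; exists i => //=; rewrite mem_index_enum.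
Qed.

Lemma measure_packing_le d (T : measurableType d) (R : realType)
    (mu : {measure set T -> \bar R}) (I : finType) (P : pred I)
    (E : I -> set T) (v : R) (A : set T) :
  measurable A -> (forall i, P i -> measurable (E i)) ->
  (forall i, P i -> v%:E <= mu (E i))%E ->
  (forall i j x, E i x -> E j x -> i = j) ->
  (forall i, P i -> E i `<=` A) ->
  ((v *+ #|P|)%:E <= mu A)%E.
Proof.
move=> mA mE Ev Einj EA.
have mU r : measurable (\big[setU/set0]_(i <- r | P i) E i).
  exact: bigsetU_measurable.
have H r : uniq r ->
    ((\sum_(i <- r | P i) v)%:E <= mu (\big[setU/set0]_(i <- r | P i) E i))%E.
  elim: r => [|i r IH]/=; first by rewrite !big_nil measure0.
  move=> /andP[ir /IH {}IH]; rewrite !big_cons; case: ifPn => // Pi.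
  rewrite EFinD measureU//; [|exact: mE|].
    by rewrite leeD// Ev.
  apply/seteqP; split => // x [Eix]; rewrite -bigcup_seq_cond => -[j /= /andP[jr _] Ejx].
  by rewrite (Einj _ _ _ Eix Ejx) jr in ir.
rewrite -sumr_const; apply: le_trans (H _ (index_enum_uniq I)) _.
apply: le_measure; rewrite ?inE// -bigcup_seq_cond => x [i /= /andP[_ Pi]].
exact: EA.
Qed.

(** [A] may be any set, in particular a convex set that is not Borel: it is enclosed in the
    measurable union of the pieces, and [volume] is monotone. [volume_packing] uses the same union
    from inside. *)
Lemma volume_cover (R : realType) (n : nat) (I : finType) (P : pred I)
    (E : I -> set 'rV[R]_n) (v : R) (A : set 'rV[R]_n) :
  (forall i, P i -> measurable_rows (E i)) ->
  (forall i, P i -> volume (E i) <= v%:E)%E ->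
  (forall x, A x -> exists2 i, P i & E i x) ->
  (volume A <= (v *+ #|P|)%:E)%E.
Proof.
move=> mE Ev AE.
pose U : set 'rV[R]_n := \big[setU/set0]_(i | P i) E i.
have mU : measurable_rows U.
  rewrite /measurable_rows /U (big_morph _ (preimage_setU _) (preimage_set0 _)).
  exact: bigsetU_measurable.
have AU : A `<=` U.
  move=> x /AE[i Pi Eix]; rewrite /U -bigcup_seq_cond.
  by exists i => //=; rewrite mem_index_enum.
apply: le_trans (le_volume AU) _; rewrite volumeE//.
apply: (le_measure_cover (E := fun i => @row_of_tuple R n @^-1` E i)) => //.
  by move=> i Pi; have := Ev i Pi; rewrite volumeE//; exact: mE.
move=> t; rewrite /U -bigcup_seq_cond => -[i /= /andP[_ Pi] Eit].
by exists i.
Qed.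

Lemma volume_packing (R : realType) (n : nat) (I : finType) (P : pred I)
    (E : I -> set 'rV[R]_n) (v : R) (A : set 'rV[R]_n) :
  (forall i, P i -> measurable_rows (E i)) ->
  (forall i, P i -> v%:E <= volume (E i))%E ->
  (forall i j x, E i x -> E j x -> i = j) ->
  (forall i, P i -> E i `<=` A) ->
  ((v *+ #|P|)%:E <= volume A)%E.
Proof.
move=> mE Ev Einj EA.
pose U : set 'rV[R]_n := \big[setU/set0]_(i | P i) E i.
have mU : measurable_rows U.
  rewrite /measurable_rows /U (big_morph _ (preimage_setU _) (preimage_set0 _)).
  exact: bigsetU_measurable.
have UA : U `<=` A.
  by move=> x; rewrite /U -bigcup_seq_cond => -[i /= /andP[_ Pi]]; exact: EA.
apply: le_trans (le_volume UA); rewrite volumeE//.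
apply: (measure_packing_le (E := fun i => @row_of_tuple R n @^-1` E i)) => //.
- by move=> i Pi; have := Ev i Pi; rewrite volumeE//; exact: mE.
- by move=> i j t; exact: Einj.
- move=> i Pi t /= Eit; rewrite /U -bigcup_seq_cond.
  by exists i => //=; rewrite mem_index_enum.
Qed.

(** * Grid cells *)

(* [P] maps vectors to their coordinates in the frame of the grid. *)
Definition cell (R : realType) (n : nat) (c : 'rV[R]_n) (P : 'M[R]_n)
    (z : 'rV[R]_n) (h : R) : set 'rV[R]_n :=
  [set y | forall i, z ord0 i <= ((y - c) *m P) ord0 i < z ord0 i + h].

Lemma measurable_cell (R : realType) (n : nat) (c : 'rV[R]_n) (P : 'M[R]_n)
    (z : 'rV[R]_n) (h : R) : measurable_rows (cell c P z h).
Proof.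
pose f i (t : n.-tuple (measurableTypeR R)) : R :=
  \sum_(j < n) (tnth t j - c ord0 j) * P j i.
have mf i : measurable_fun setT (f i).
  apply: measurable_sum => j; apply: measurable_realfun.measurable_funM => //.
  by apply: measurable_realfun.measurable_funB => //; exact: measurable_tnth.
rewrite /measurable_rows (_ : _ @^-1` _ = \bigcap_(i in [set: 'I_n])
    (f i @^-1` `[z ord0 i, z ord0 i + h[%classic)).
  by apply: fin_bigcap_measurable => // i _; rewrite -[X in measurable X]setTI;
    exact: mf.
have fE t i : ((row_of_tuple t - c) *m P) ord0 i = f i t.
  by rewrite mxE; apply: eq_bigr => j _; rewrite !mxE.
apply/seteqP; split => t /= H i; have := H i; rewrite /= in_itv/= fE//.
exact.
Qed.

(** With [P'] the inverse of [P], the cell is the translate by [c + z *m P'] of the cell at the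
    origin. All cells of one frame therefore share one volume, still unknown when the frame is not
    the standard one. *)
Lemma volume_cell_translate (R : realType) (n : nat) (c : 'rV[R]_n)
    (P P' : 'M[R]_n) (z : 'rV[R]_n) (h : R) : P' *m P = 1%:M ->
  volume (cell c P z h) = volume (cell 0 P 0 h).
Proof.
move=> PP.
have [_ <-] := volume_translate (- (c + z *m P')) (measurable_cell 0 P 0 h).
have E y : (- (c + z *m P') + y) *m P = (y - c) *m P - z.
  by rewrite opprD addrC addrA mulmxBl -mulmxA PP mulmx1.
by congr volume; apply/seteqP; split => y /= H i; have := H i;
  rewrite subr0 E !mxE add0r subr_ge0 ltrBlDl.
Qed.

Lemma volume_axis_cell (R : realType) (n : nat) (z : 'rV[R]_n) (h : R) :
  0 < h -> volume (cell 0 1%:M z h) = (h ^+ n)%:E.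
Proof.
move=> h0; rewrite volumeE; last exact: measurable_cell.
rewrite -(lebesgue_tuple_box z h0); congr (lebesgue_tuple_measure R n _).
by apply/seteqP; split => t /= H i; have := H i; rewrite subr0 mulmx1 mxE.
Qed.

Definition grid_point (R : realType) (n M : nat) (o h : R)
    (k : {ffun 'I_n -> 'I_M}) : 'rV[R]_n := \row_i (o + (k i)%:R * h).

(** Cells are half-open, so a common point forces [k i < l i + 1] and [l i < k i + 1] for every
    [i]. *)
Lemma grid_cell_inj (R : realType) (n M : nat) (o h : R)
    (k l : {ffun 'I_n -> 'I_M}) c P y : 0 < h ->
  cell c P (grid_point o h k) h y -> cell c P (grid_point o h l) h y -> k = l.
Proof.
move=> h0 ky ly; apply/ffunP => i; apply/val_inj/eqP; rewrite eqn_leq.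
have E a : o + a * h + h = o + (a + 1) * h by ring.
have := ky i; have := ly i; rewrite ![grid_point _ _ _ _ _]mxE !E => /andP[l1 l2] /andP[k1 k2].
have := le_lt_trans l1 k2; have := le_lt_trans k1 l2.
by rewrite !ltrD2l !ltr_pM2r// !natr1 !ltr_nat !ltnS => -> ->.
Qed.

Lemma grid_cell_exists (R : realType) (n M : nat) (o h : R) c P (y : 'rV[R]_n) :
  0 < h -> (forall i, o <= ((y - c) *m P) ord0 i < o + M%:R * h) ->
  exists k : {ffun 'I_n -> 'I_M}, cell c P (grid_point o h k) h y.
Proof.
move=> h0 H; set u := (y - c) *m P in H *.
have u0 i : 0 <= (u ord0 i - o) / h.
  by have /andP[oi _] := H i; rewrite divr_ge0 ?subr_ge0// ltW.
have uM i : (Num.truncn ((u ord0 i - o) / h) < M)%N.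
  have /andP[_ oi] := H i.
  rewrite -(ltr_nat R) (@le_lt_trans _ _ ((u ord0 i - o) / h)) ?truncn_le//.
  by rewrite ltr_pdivrMr// ltrBlDl.
exists [ffun i => Ordinal (uM i)] => i; rewrite -/u [grid_point _ _ _ _ _]mxE ffunE /=.
have /andP[t1 t2] := truncn_itv (u0 i); apply/andP; split.
  by rewrite -lerBrDl -ler_pdivlMr//.
by rewrite -addrA -[X in _ < _ + (_ + X)]mul1r -mulrDl natr1 -ltrBlDl -ltr_pdivrMr//.
Qed.

(** [K] has volume 1 and contains [N ^ n] disjoint cells of equal volume. *)
Lemma volume_grid_cell_le (R : realType) (n N : nat) (c : 'rV[R]_n)
    (P P' : 'M[R]_n) : P' *m P = 1%:M -> (0 < N)%N ->
  volume [set y | forall i, 0 <= ((y - c) *m P) ord0 i <= 1] = 1%:E ->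
  (volume (cell 0 P 0 N%:R^-1) <= (N%:R ^- n)%:E)%E.
Proof.
move=> PP N0; set K := [set y | _] => vK; set w := volume _.
have N0' : 0 < N%:R :> R by rewrite ltr0n.
have cellK (k : {ffun 'I_n -> 'I_N}) : cell c P (grid_point 0 N%:R^-1 k) N%:R^-1 `<=` K.
  move=> y ky i; have := ky i; rewrite [grid_point _ _ _ _ _]mxE add0r => /andP[k1 k2].
  rewrite (le_trans _ k1) ?divr_ge0//= (le_trans (ltW k2))//.
  by rewrite -[X in _ + X]mul1r -mulrDl natr1 ler_pdivrMr// mul1r ler_nat.
have wE (k : {ffun 'I_n -> 'I_N}) : volume (cell c P (grid_point 0 N%:R^-1 k) N%:R^-1) = w.
  by rewrite (volume_cell_translate _ _ _ PP).
(* A single cell inside [K] already shows that [w] is finite, so that it can be handled as a real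
   number. *)
have w1 : (w <= 1)%E.
  by rewrite -vK -(wE [ffun=> Ordinal N0]); exact/le_volume/cellK.
have w0 : (0 <= w)%E by rewrite /w /volume -lebesgue_tuple_measureE mu_ext_ge0.
have wf : w \is a fin_num.
  by rewrite ge0_fin_numE// (le_lt_trans w1)// ltry.
have : (((fine w) *+ #|{: {ffun 'I_n -> 'I_N}}|)%:E <= volume K)%E.
  apply: (volume_packing (E := fun k => cell c P (grid_point 0 N%:R^-1 k) N%:R^-1)) => //.
  - by move=> k _; exact: measurable_cell.
  - by move=> k _; rewrite wE fineK.
  - by move=> k l x; apply: grid_cell_inj; rewrite invr_gt0.
rewrite vK card_ffun !card_ord lee_fin -{2}(fineK wf) lee_fin => H.
by rewrite -[leRHS]mul1r ler_pdivlMr ?exprn_gt0// -natrX mulr_natr.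
Qed.

Lemma volume_le_hits (R : realType) (n N M : nat) (o : R) (c : 'rV[R]_n)
    (P P' : 'M[R]_n) (A : set 'rV[R]_n) : P' *m P = 1%:M -> (0 < N)%N ->
  (volume (cell 0 P 0 N%:R^-1) <= (N%:R ^- n)%:E)%E ->
  (forall y, A y -> forall i, o <= ((y - c) *m P) ord0 i < o + M%:R * N%:R^-1) ->
  (volume A <= (N%:R ^- n *+ #|[pred k : {ffun 'I_n -> 'I_M} |
     `[< A `&` cell c P (grid_point o N%:R^-1 k) N%:R^-1 !=set0 >]]|)%:E)%E.
Proof.
move=> PP N0 vN AM.
apply: (volume_cover (E := fun k => cell c P (grid_point o N%:R^-1 k) N%:R^-1)).
- by move=> k _; exact: measurable_cell.
- by move=> k _; rewrite (volume_cell_translate _ _ _ PP).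
- move=> x Ax.
  have [|k xk] := @grid_cell_exists R n M o N%:R^-1 c P x _ (AM _ Ax).
    by rewrite invr_gt0 ltr0n.
  by exists k => //; rewrite inE; apply/asboolP; exists x.
Qed.

(** * Side of a cube of unit volume *)

Lemma dotpE (R : realType) (n : nat) (x y : 'rV[R]_n) :
  dotp x y = (x *m y^T) ord0 ord0.
Proof. by rewrite mxE; apply: eq_bigr => i _; rewrite mxE. Qed.

Lemma dotp_ge0 (R : realType) (n : nat) (x : 'rV[R]_n) : 0 <= dotp x x.
Proof. by apply: sumr_ge0 => i _; rewrite -expr2 sqr_ge0. Qed.

Lemma dotp_orthogonal (R : realType) (n : nat) (Q : 'M[R]_n) (x y : 'rV[R]_n) :
  Q *m Q^T = 1%:M -> dotp (x *m Q) (y *m Q) = dotp x y.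
Proof. by move=> QQ; rewrite !dotpE trmx_mul mulmxA -(mulmxA x) QQ mulmx1. Qed.

Lemma dotpZ (R : realType) (n : nat) (s : R) (x : 'rV[R]_n) :
  dotp (s *: x) (s *: x) = s ^+ 2 * dotp x x.
Proof. by rewrite /dotp mulr_sumr; apply: eq_bigr => i _; rewrite !mxE; ring. Qed.

Lemma le_dotp (R : realType) (n : nat) (x : 'rV[R]_n) i :
  x ord0 i ^+ 2 <= dotp x x.
Proof.
rewrite /dotp (bigD1 i)//= -expr2 lerDl; apply: sumr_ge0 => j _.
by rewrite -expr2 sqr_ge0.
Qed.

Lemma dotp_norm_le (R : realType) (n : nat) (x : 'rV[R]_n) (r : R) i :
  0 <= r -> dotp x x < r ^+ 2 -> `|x ord0 i| < r.
Proof.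
move=> r0 xr; rewrite -(ltr_pXn2r (n := 2))// ?nnegrE// real_normK ?num_real//.
exact: le_lt_trans (le_dotp _ _) xr.
Qed.

Lemma dotp_perturb_lt (R : realType) (n : nat) (u x : 'rV[R]_n) (r h : R) :
  0 <= r -> 0 <= h -> dotp u u < r ^+ 2 ->
  (forall i, `|x ord0 i - u ord0 i| <= h) ->
  dotp x x < (r + n%:R * h) ^+ 2.
Proof.
move=> r0 h0 ur xu.
have : dotp x x <= \sum_(i < n) (u ord0 i * u ord0 i + (2 * r * h + h ^+ 2)).
  apply: ler_sum => i _.
  have /ltr_normlP[u1 u2] := dotp_norm_le i r0 ur.
  have /ler_normlP[x1 x2] := xu i.
  nra.
rewrite big_split/= sumr_const card_ord -/(dotp u u) => /le_lt_trans; apply.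
(* This turns the term [n h^2] of the sum into the term [(n h)^2] of the expanded square. *)
have nn : n%:R <= n%:R ^+ 2 :> R by rewrite -natrX ler_nat; case: (n) => // m; rewrite expnS leq_pmulr.
have := ler_wpM2r (sqr_ge0 h) nn.
by rewrite -mulr_natl; nra.
Qed.

Definition eball (R : realType) (n : nat) (r : R) : set 'rV[R]_n :=
  [set y | dotp y y < r ^+ 2].
Arguments eball {R n}.

(** In the coordinates given by [P] the ball of radius [s * r] becomes the ball of radius [r]. The
    cells it meets have volume at most [N^-n] each, while the axis-parallel cells with the same
    indices have volume exactly [N^-n] and fit in the ball of radius [r + e]. *)
Lemma volume_eball_shrink (R : realType) (n : nat) (P P' : 'M[R]_n) (s r e : R) :
  P' *m P = 1%:M ->
  (forall y : 'rV_n, dotp (y *m P) (y *m P) = s ^- 2 * dotp y y) ->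
  (forall N, (0 < N)%N ->
    (volume (cell 0 P 0 N%:R^-1) <= (N%:R ^- n)%:E)%E) ->
  0 < s -> 0 < r -> 0 < e ->
  (volume (@eball R n (s * r)) <= volume (@eball R n (r + e)))%E.
Proof.
move=> PP Ps vP s0 r0 e0.
(* Moving within a cell of side [1 / N] enlarges the norm by at most [n / N <= e]. Since [r <= L], a
   grid of [2 L N] cells per axis starting at [- L] covers the ball of radius [r]. *)
pose N := (Num.truncn (n%:R / e)).+1; pose L := (Num.truncn r).+1.
have N0 : 0 < N%:R :> R by rewrite ltr0n.
have Ne : n%:R * N%:R^-1 <= e.
  rewrite ler_pdivrMr// -ler_pdivrMl// mulrC ltW//.
  by have /andP[_] := truncn_itv (divr_ge0 (ler0n R n) (ltW e0)).
have rL : r <= L%:R by have /andP[_ /ltW] := truncn_itv (ltW r0).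
have small y : eball (s * r) y -> dotp (y *m P) (y *m P) < r ^+ 2.
  by rewrite /eball /= Ps exprMn => yb; rewrite mulrC ltr_pdivrMr ?exprn_gt0// mulrC.
apply: (@le_trans _ _ _ _ _ (@volume_le_hits R n N (2 * L * N) (- L%:R) 0 P P'
  (eball (s * r)) PP isT (vP N isT) _)).
  move=> y /small yr i; rewrite subr0.
  have /ltr_normlP[y1 y2] := dotp_norm_le i (ltW r0) yr.
  rewrite !natrM mulfK ?gt_eqF//; apply/andP; split; lra.
apply: (volume_packing
  (E := fun k => cell 0 1%:M (grid_point (- L%:R) N%:R^-1 k) N%:R^-1)).
- by move=> k _; exact: measurable_cell.
- by move=> k _; rewrite volume_axis_cell ?invr_gt0// exprVn.
- by move=> k l x; apply: grid_cell_inj; rewrite invr_gt0.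
- move=> k /asboolP[y [/small yr yk]] x xk.
  have h0 : 0 <= N%:R^-1 :> R by rewrite invr_ge0 ltW.
  have lt_x : dotp x x < (r + n%:R * N%:R^-1) ^+ 2.
    apply: dotp_perturb_lt (ltW r0) h0 yr _ => i.
    have /andP[y1 y2] := yk i; have /andP[x1 x2] := xk i.
    move: y1 y2 x1 x2; rewrite !subr0 mulmx1 => y1 y2 x1 x2.
    by apply/ler_normlP; split; lra.
  by apply: (lt_le_trans lt_x); rewrite lerXn2r ?nnegrE ?addr_ge0 ?lerD2l// ?mulr_ge0// ltW.
Qed.

Lemma bernoulli_le (R : realType) (x : R) (k : nat) :
  0 <= 1 + x -> 1 + k%:R * x <= (1 + x) ^+ k.
Proof.
move=> x0; elim: k => [|k IH]; first by rewrite mul0r addr0.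
rewrite exprS; apply: le_trans (ler_wpM2l x0 IH).
have : 0 <= k%:R * x ^+ 2 by rewrite mulr_ge0 ?sqr_ge0.
by rewrite -natr1; nra.
Qed.

Lemma eball_shrink_le1 (R : realType) (n : nat) (s : R) : (0 < n)%N -> 0 < s ->
  (forall r e : R, 0 < r -> 0 < e ->
    (volume (@eball R n (s * r)) <= volume (@eball R n (r + e)))%E) ->
  s <= 1.
Proof.
move=> n0 s0 H; rewrite leNgt; apply/negP => s1.
(* If [1 < s], the balls of radius [t ^ k] have bounded volume, where
   [t = s / q > 1]; yet they contain a cube of side 3 for large [k]. *)
pose q := (1 + s) / 2; pose t := s / q.
have q0 : 0 < q by rewrite /q; lra.
have t1 : 1 < t by rewrite /t ltr_pdivlMr// mul1r /q; lra.
have t0 : 0 < t by apply: lt_trans t1.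
(* The hypothesis is used with radius [r / q] and slack [r - r / q], which is positive because [q],
   the midpoint of 1 and [s], exceeds 1. *)
have step r : 0 < r -> (volume (@eball R n (t * r)) <= volume (@eball R n r))%E.
  move=> r0; have := H (r / q) (r - r / q); rewrite subrKC mulrA mulrAC.
  by apply; [rewrite divr_gt0|rewrite subr_gt0 ltr_pdivrMr// ltr_pMr// /q; lra].
have iter k : (volume (@eball R n (t ^+ k)) <= volume (@eball R n 1))%E.
  elim: k => // k; apply: le_trans.
  by rewrite exprS step// exprn_gt0.
have up : (volume (@eball R n 1) <= (2 ^+ n)%:E)%E.
  rewrite -(@volume_axis_cell R n (const_mx (- 1)) 2)//; apply: le_volume => y yb i.
  have /ltr_normlP[y1 y2] := dotp_norm_le i ler01 yb.
  by rewrite subr0 mulmx1 mxE; apply/andP; split; lra.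
(* Points of [[0, 3)^n] have squared norm at most [9 n]; Bernoulli's inequality makes [t ^ k], and
   hence its square, larger than this. The volumes [3 ^ n] and [2 ^ n] then contradict each other,
   as [n > 0]. *)
pose k := (Num.truncn (9 * n%:R / (t - 1))).+1.
have kt : 9 * n%:R < k%:R * (t - 1).
  rewrite -ltr_pdivrMr ?subr_gt0//.
  have ge0 : 0 <= 9 * n%:R / (t - 1) by rewrite divr_ge0 ?mulr_ge0// subr_ge0 ltW.
  by have /andP[] := truncn_itv ge0.
have tk : 9 * n%:R < t ^+ k.
  apply: lt_trans kt _; have := @bernoulli_le R (t - 1) k; rewrite subrKC.
  by move=> /(_ (ltW t0)); lra.
have low : ((3 ^+ n)%:E <= volume (@eball R n (t ^+ k)))%E.
  rewrite -(@volume_axis_cell R n 0 3)//; apply: le_volume => y yb.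
  rewrite /eball /=; apply: (@le_lt_trans _ _ (9 * n%:R)); last first.
    apply: lt_le_trans tk _; rewrite expr2 ler_peMl ?exprn_ge0 ?(ltW t0)//.
    by rewrite exprn_ege1// ltW.
  rewrite mulr_natr -[X in _ *+ X]card_ord -sumr_const; apply: ler_sum => i _.
  by have := yb i; rewrite subr0 mulmx1 mxE add0r; nra.
have := le_trans low (le_trans (iter k) up).
by rewrite lee_fin leNgt ltr_pXn2r ?nnegrE// ltr_nat.
Qed.

(** * Distance between convex sets *)

Lemma dotp_segment (R : realType) (n : nat) (w d : 'rV[R]_n) (t : R) :
  dotp (w + t *: (d - w)) (w + t *: (d - w)) =
  dotp w w + 2 * t * (dotp w d - dotp w w) + t ^+ 2 * dotp (d - w) (d - w).
Proof.
rewrite /dotp -sumrB !mulr_sumr -!big_split; apply: eq_bigr => i _.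
by rewrite !mxE/=; ring.
Qed.

Lemma convex_set_segment (R : realType) (n : nat) (A : set 'rV[R]_n) :
  @convex_set R 'rV[R]_n A ->
  forall x y (t : R), A x -> A y -> 0 <= t <= 1 -> A (x + t *: (y - x)).
Proof.
move=> cA x y t Ax Ay /andP[t0 t1].
have := cA y x (Itv01 t0 t1) (mem_set Ay) (mem_set Ax); rewrite inE /=.
congr A; rewrite /conv /= scalerBl scale1r scalerBr.
by rewrite addrCA.
Qed.

(** The sets need not be closed, so the infimum [m] is only nearly attained, by [w]. Moving from [w]
    a fraction [t] of the way to [d = x - y] stays among the differences, so [m] is at most [|w|^2 +
    2 t (<w, d> - |w|^2) + t^2 |d - w|^2]; dividing by [t] yields the bound on [<w, d>]. *)
Lemma near_minimizer_separates (R : realType) (n : nat) (A B : set 'rV[R]_n)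
    (D : R) :
  (forall x y (t : R), A x -> A y -> 0 <= t <= 1 -> A (x + t *: (y - x))) ->
  (forall x y (t : R), B x -> B y -> 0 <= t <= 1 -> B (x + t *: (y - x))) ->
  A `<=` unit_cube R n -> B `<=` unit_cube R n -> A !=set0 -> B !=set0 ->
  0 < D -> (forall x y, A x -> B y -> D <= dotp (x - y) (x - y)) ->
  exists m w, [/\ D <= m, dotp w w <= 2 * m &
    forall x y, A x -> B y -> m / 2 <= dotp w (x - y)].
Proof.
move=> cA cB AK BK [a Aa] [b Bb] D0 AB.
pose S := [set dotp (x - y) (x - y) | x in A & y in B].
have Sab : S (dotp (a - b) (a - b)) by exists a => //; exists b.
have lbS : lbound S D by move=> _ [x Ax [y By <-]]; exact: AB.
have hS : has_inf S by split; [exists (dotp (a - b) (a - b))|exists D].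
pose m := inf S.
have Dm : D <= m by apply: lb_le_inf => //; exists (dotp (a - b) (a - b)).
have mS x y : A x -> B y -> m <= dotp (x - y) (x - y).
  by move=> Ax By; apply: ge_inf; [exists D|exists x => //; exists y].
have m0 : 0 < m by apply: lt_le_trans Dm.
have mn : m <= n%:R.
  apply: le_trans (mS _ _ Aa Bb) _.
  rewrite -[n in leRHS]card_ord -sumr_const; apply: ler_sum => i _.
  by have /andP[? ?] := AK _ Aa i; have /andP[? ?] := BK _ Bb i; rewrite !mxE; nra.
have n0 : 0 < n%:R :> R by apply: lt_le_trans mn.
(* As [|d - w|^2 <= 4 n] in the unit cube, this [t] makes the quadratic term at most [t * m / 2].
   The tolerance for [w] is also [t * m / 2], and the two errors together leave [m / 2]. The bound
   [m <= n] ensures [t <= 1]. *)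
pose t : R := m / (8 * n%:R).
have t0 : 0 < t by rewrite divr_gt0// mulr_gt0.
have t1 : t <= 1 by rewrite ler_pdivrMr ?mulr_gt0//; lra.
have tE : 8 * n%:R * t = m by rewrite /t mulrC mulfVK// gt_eqF// mulr_gt0.
have tm0 : 0 < t * m / 2 by rewrite divr_gt0// mulr_gt0.
have [_ [x0 Ax0 [y0 By0 <-]] wm] := inf_adherent tm0 hS.
rewrite -/m in wm; pose w : 'rV[R]_n := x0 - y0.
exists m, w; split=> //.
  by apply: ltW; apply: (lt_le_trans wm); nra.
move=> x y Ax By; pose d : 'rV[R]_n := x - y.
have t01 : 0 <= t <= 1 by rewrite ltW.
have := mS _ _ (cA _ _ _ Ax0 Ax t01) (cB _ _ _ By0 By t01).
have -> : x0 + t *: (x - x0) - (y0 + t *: (y - y0)) = w + t *: (d - w).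
  by apply/rowP => i; rewrite !mxE; ring.
rewrite dotp_segment.
have dw : dotp (d - w) (d - w) <= 4 * n%:R.
  rewrite mulr_natr -[n in leRHS]card_ord -sumr_const; apply: ler_sum => i _.
  have /andP[? ?] := AK _ Ax i; have /andP[? ?] := BK _ By i.
  have /andP[? ?] := AK _ Ax0 i; have /andP[? ?] := BK _ By0 i.
  by rewrite !mxE; nra.
have := mS _ _ Ax0 By0; rewrite -/w => mw.
have := ler_wpM2l (sqr_ge0 t) dw.
have := ler_wpM2l (ltW t0) mw.
rewrite -/w in wm => h1 h2 h3.
have t4 : t ^+ 2 * (4 * n%:R) = t * m / 2 by rewrite -tE; field.
rewrite -(ler_pM2l t0); nra.
Qed.

(** * Second moments on the grid and Chebyshev's inequality *)

(** The factors [2 * k i + 1 - M] are twice the offsets of the cell centres from the middle of the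
    grid, in units of the cell side. Distinct coordinates are uncorrelated, so only diagonal terms
    survive; each square is bounded crudely by [M ^ 2], over [M ^ n] indices. *)
Lemma grid_second_moment (R : realType) (n M : nat) (w : 'rV[R]_n) :
  \sum_(k : {ffun 'I_n -> 'I_M})
    (\sum_(i < n) w ord0 i * (2 * (k i)%:R + 1 - M%:R)) ^+ 2 <=
  dotp w w * M%:R ^+ (n + 2).
Proof.
pose u (a : 'I_M) : R := 2 * a%:R + 1 - M%:R.
have uM a : u a ^+ 2 <= M%:R ^+ 2.
  have : a%:R + 1 <= M%:R :> R by rewrite natr1 ler_nat.
  by have : 0 <= a%:R :> R := ler0n _ _; rewrite /u; nra.
have urev a : u (rev_ord a) = - u a.
  have : (rev_ord a)%:R + (a%:R + 1) = M%:R :> R.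
    by rewrite natr1 -natrD /= subnK.
  by rewrite /u; lra.
have cross i j : i != j -> \sum_(k : {ffun 'I_n -> 'I_M}) u (k i) * u (k j) = 0.
  move=> ij.
  (* Reversing the [i]-th coordinate changes the sign of the covariance. *)
  pose f (k : {ffun 'I_n -> 'I_M}) :=
    [ffun l => if l == i then rev_ord (k l) else k l].
  have fK : involutive f.
    by move=> k; apply/ffunP => l; rewrite !ffunE; case: (l == i); rewrite ?rev_ordK.
  suff : \sum_(k : {ffun 'I_n -> 'I_M}) u (k i) * u (k j) =
    - \sum_(k : {ffun 'I_n -> 'I_M}) u (k i) * u (k j) by lra.
  rewrite {1}(reindex_inj (inv_inj fK)) -sumrN; apply: eq_bigr => k _.
  by rewrite !ffunE eqxx eq_sym (negbTE ij) urev mulNr.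
have -> : \sum_(k : {ffun 'I_n -> 'I_M})
    (\sum_(i < n) w ord0 i * (2 * (k i)%:R + 1 - M%:R)) ^+ 2 =
  \sum_(i < n) \sum_(j < n) w ord0 i * w ord0 j *
    \sum_(k : {ffun 'I_n -> 'I_M}) u (k i) * u (k j).
  under eq_bigr do rewrite expr2 big_distrlr.
  rewrite exchange_big; apply: eq_bigr => i _.
  rewrite exchange_big; apply: eq_bigr => j _.
  by rewrite mulr_sumr; apply: eq_bigr => k _; rewrite /u /=; ring.
rewrite /dotp mulr_suml; apply: ler_sum => i _.
rewrite (bigD1 i)//= [X in _ + X]big1 ?addr0 => [|j ji]; last first.
  by rewrite cross ?mulr0// eq_sym.
rewrite ler_wpM2l// -?expr2 ?sqr_ge0//.
rewrite exprD -[M%:R ^+ n]natrX mulr_natl.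
have <- : #|{: {ffun 'I_n -> 'I_M}}| = (M ^ n)%N by rewrite card_ffun !card_ord.
by rewrite -sumr_const; apply: ler_sum => k _; rewrite -expr2.
Qed.

(** A discrete substitute for volume at least [eps], stated in the frame of the cube. There are
    [N.+1] indices per axis because a coordinate equal to 1 falls in the half-open cell of index
    [N]. *)
Definition grid_large (R : realType) (n : nat) (eps : R) (A : set 'rV[R]_n) :=
  forall N, (0 < N)%N -> exists H : pred {ffun 'I_n -> 'I_N.+1},
    eps * N%:R ^+ n <= #|H|%:R /\
    forall k, H k -> exists2 x, A x &
      forall i, (k i)%:R * N%:R^-1 <= x ord0 i <= (k i)%:R * N%:R^-1 + N%:R^-1.

(** Bernoulli's inequality for [(1 - 1 / (N + 1)) ^ p]. It absorbs the extra layer of cells, of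
    which there are [N + 1] per axis instead of [N]. *)
Lemma grid_ratio_lt2 (R : realType) (p N : nat) : (2 * p < N.+1)%N ->
  N.+1%:R ^+ p < 2 * N%:R ^+ p :> R.
Proof.
move=> pN; have M0 : 0 < N.+1%:R :> R by rewrite ltr0n.
have x0 : 0 <= 1 + - N.+1%:R^-1 :> R.
  by rewrite subr_ge0 invf_le1// ler1n.
have := bernoulli_le p x0; rewrite mulrN.
have -> : 1 + - N.+1%:R^-1 = N%:R / N.+1%:R :> R.
  have nM : N.+1%:R != 0 :> R by rewrite gt_eqF.
  by apply: (mulIf nM); rewrite mulrDl mulNr mulVf// mulfVK// mul1r -natr1 addrK.
have : p%:R / N.+1%:R < 2^-1 :> R.
  rewrite ltr_pdivrMr// ltr_pdivlMl//; first by rewrite -natrM ltr_nat.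
rewrite expr_div_n => h1 h2.
have : 2^-1 < N%:R ^+ p / N.+1%:R ^+ p :> R.
  by move: h1 h2; set a := p%:R / _; set b := _ / _ ^+ p; lra.
by rewrite ltr_pdivlMr ?exprn_gt0// ltr_pdivrMl.
Qed.

Lemma convex_sets_close (R : realType) (n : nat) (eps : R) (A B : set 'rV[R]_n) :
  0 < eps ->
  (forall x y (t : R), A x -> A y -> 0 <= t <= 1 -> A (x + t *: (y - x))) ->
  (forall x y (t : R), B x -> B y -> 0 <= t <= 1 -> B (x + t *: (y - x))) ->
  A `<=` unit_cube R n -> B `<=` unit_cube R n ->
  grid_large eps A -> grid_large eps B ->
  exists x y, [/\ A x, B y & dotp (x - y) (x - y) <= 64 / eps].
Proof.
move=> e0 cA cB AK BK gA gB; apply: contrapT => far.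
have ne (S : set 'rV[R]_n) : grid_large eps S -> S !=set0.
  move=> /(_ 1%N isT)[H [cH HS]]; rewrite expr1n mulr1 in cH.
  have /card_gt0P[k /HS[x Sx _]] : (0 < #|H|)%N.
    by rewrite -(ltr_nat R); apply: lt_le_trans cH.
  by exists x.
have D0 : 0 < 64 / eps by rewrite divr_gt0.
have [|m [w [Dm wm sep]]] := near_minimizer_separates cA cB AK BK (ne _ gA) (ne _ gB) D0.
  move=> x y Ax By; rewrite leNgt; apply/negP => /ltW xy.
  by apply: far; exists x, y.
have m0 : 0 < m by apply: lt_le_trans Dm.
pose S : R := \sum_(i < n) `|w ord0 i|.
have S0 : 0 <= S by apply: sumr_ge0.
(* The first summand keeps the discretisation error [S] below [N * m / 4]; the second makes
   [((N + 1) / N) ^ (n + 2)] less than 2. *)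
pose N := ((Num.truncn (4 * S / m)).+1 + 2 * (n + 2))%N.
have N0 : (0 < N)%N by rewrite /N addSn.
have N0' : 0 < N%:R :> R by rewrite ltr0n.
have NS : 4 * S <= N%:R * m.
  rewrite -ler_pdivrMr// ltW//.
  have S4 : 0 <= 4 * S / m by rewrite divr_ge0 ?mulr_ge0// ltW.
  have /andP[_ /lt_le_trans] := truncn_itv S4; apply.
  by rewrite ler_nat leq_addr.
have NM : N.+1%:R ^+ (n + 2) < 2 * N%:R ^+ (n + 2) :> R.
  by apply: grid_ratio_lt2; rewrite ltnS leq_addl.
have [HA [cHA hA]] := gA N N0; have [HB [cHB hB]] := gB N N0.
pose X (k : {ffun 'I_n -> 'I_N.+1}) : R :=
  \sum_(i < n) w ord0 i * (2 * (k i)%:R + 1 - N.+1%:R).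
have XX k l : HA k -> HB l -> N%:R * m / 2 <= X k - X l.
  move=> /hA[x Ax xk] /hB[y By yl].
  have := sep x y Ax By.
  (* Replacing [x] and [y] by the corners of their cells changes each [N * (x_i - y_i)] by at most
     1, hence the scaled inner product by at most [S]. *)
  suff : N%:R * dotp w (x - y) <= (X k - X l) / 2 + S.
    have h1 : N%:R * m / 2 <= N%:R * dotp w (x - y) ->
              N%:R * dotp w (x - y) <= (X k - X l) / 2 + S ->
              N%:R * m / 2 <= X k - X l by lra.
    move=> h2 h3; apply: h1 => //.
    by rewrite -mulrA ler_pM2l.
  rewrite /dotp /X /S mulr_sumr -sumrB mulr_suml -big_split/=; apply: ler_sum => i _.
  have /andP[x1 x2] := xk i; have /andP[y1 y2] := yl i.
  have Nx a (z : R) : (a%:R * N%:R^-1 <= z) = (a%:R <= N%:R * z) :> bool.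
    by rewrite ler_pdivrMr// mulrC.
  have Nz a (z : R) : (z <= a%:R * N%:R^-1 + N%:R^-1) = (N%:R * z <= a%:R + 1) :> bool.
    by rewrite -[X in _ + X]mul1r -mulrDl ler_pdivlMr// mulrC.
  move: x1 x2 y1 y2; rewrite !Nx !Nz => x1 x2 y1 y2.
  rewrite !mxE; set e := N%:R * (x ord0 i - y ord0 i) - ((k i)%:R - (l i)%:R).
  have -> : N%:R * (w ord0 i * (x ord0 i - y ord0 i)) =
    (w ord0 i * (2 * (k i)%:R + 1 - N.+1%:R) -
     w ord0 i * (2 * (l i)%:R + 1 - N.+1%:R)) / 2 + w ord0 i * e.
    by rewrite /e; field.
  rewrite lerD2l (le_trans (ler_norm _))// normrM ler_piMr//.
  by apply/ler_normlP; rewrite /e; split; nra.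
(* Chebyshev's inequality: otherwise the sum of the squares would be at least
   [eps * N^n * (N * m / 4)^2], while the second moment is below [4 * m * N^(n + 2)]. This would
   give [m < 64 / eps], whence the constant. *)
have low (H : pred {ffun 'I_n -> 'I_N.+1}) : eps * N%:R ^+ n <= #|H|%:R ->
    ~ (forall k, H k -> (N%:R * m / 4) ^+ 2 <= X k ^+ 2).
  move=> cH HX.
  have := @grid_second_moment R n N.+1 w; rewrite -/X => up.
  have : #|H|%:R * (N%:R * m / 4) ^+ 2 <= \sum_k X k ^+ 2.
    rewrite mulr_natl -sumr_const [leRHS](bigID H)/= ler_wpDr//.
      by apply: sumr_ge0 => k _; rewrite sqr_ge0.
    exact: ler_sum.
  move=> /le_trans/(_ up) h1.
  have h2 := le_trans (ler_wpM2r (sqr_ge0 (N%:R * m / 4)) cH) h1.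
  have h3 := ler_wpM2r (exprn_ge0 (n + 2) (ler0n R N.+1)) wm.
  have h4 : 2 * m * N.+1%:R ^+ (n + 2) < 2 * m * (2 * N%:R ^+ (n + 2)).
    by rewrite ltr_pM2l// mulr_gt0.
  have := le_lt_trans h2 (le_lt_trans h3 h4).
  have -> : eps * N%:R ^+ n * (N%:R * m / 4) ^+ 2 =
    (m * N%:R ^+ (n + 2)) * (eps * m / 16) by rewrite exprD; field.
  have -> : 2 * m * (2 * N%:R ^+ (n + 2)) = (m * N%:R ^+ (n + 2)) * 4 by ring.
  rewrite ltr_pM2l; last by rewrite mulr_gt0// exprn_gt0.
  by move: Dm; rewrite ler_pdivrMr// => Dm; lra.
have Nm0 : 0 <= N%:R * m by rewrite mulr_ge0// ltW.
(* Either [X] is at least [N * m / 4] on all the cells chosen for [A], or one of them falls below,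
   and the gap [N * m / 2] forces [X] below [- (N * m / 4)] on all those chosen for [B]. *)
have [kA|/existsNP[k /not_implyP[Hk Xk]]] :=
    pselect (forall k, HA k -> N%:R * m / 4 <= X k).
  apply: (low _ cHA) => k /kA Xk.
  by apply: lerXn2r => //; rewrite nnegrE; lra.
apply: (low _ cHB) => l Hl; have := XX k l Hk Hl.
move/negP: Xk; rewrite -ltNge => Xk kl.
by rewrite -[X l ^+ 2]sqrrN; apply: lerXn2r; rewrite ?nnegrE; lra.
Qed.

(** * Cubes in arbitrary position *)

Section CubeCoordinates.
Variables (R : realType) (n : nat) (c : 'rV[R]_n) (s : R) (Q : 'M[R]_n).
Hypotheses (s0 : 0 < s) (QQ : Q *m Q^T = 1%:M).

Let place (x : 'rV[R]_n) : 'rV[R]_n := c + s *: (x *m Q).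
Let P : 'M[R]_n := s^-1 *: Q^T.

Lemma cube_coord_mx : (s *: Q) *m (s^-1 *: Q^T) = 1%:M.
Proof. by rewrite -scalemxAl -scalemxAr QQ scalerA divff ?gt_eqF// scale1r. Qed.

Lemma cube_coordK x : (place x - c) *m P = x.
Proof.
by rewrite /place addrC addKr scalemxAr -mulmxA cube_coord_mx mulmx1.
Qed.

Lemma cube_placeK y : place ((y - c) *m P) = y.
Proof.
rewrite /place scalemxAr -mulmxA (mulmx1C cube_coord_mx) mulmx1.
by rewrite subrKC.
Qed.

Lemma cube_coord_dotp (y : 'rV[R]_n) :
  dotp (y *m P) (y *m P) = s ^- 2 * dotp y y.
Proof.
rewrite -scalemxAr dotpZ exprVn dotp_orthogonal// trmxK.
exact: mulmx1C.
Qed.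

Lemma cubeE : [set place x | x in unit_cube R n] =
  [set y | forall i, 0 <= ((y - c) *m P) ord0 i <= 1].
Proof.
apply/seteqP; split => [_ [x xK <-] i|y yK]; first by rewrite cube_coordK.
by exists ((y - c) *m P) => //; rewrite cube_placeK.
Qed.

Hypothesis vK : volume [set place x | x in unit_cube R n] = 1%:E.

Lemma volume_cube_cell N : (0 < N)%N ->
  (volume (cell 0 P 0 N%:R^-1) <= (N%:R ^- n)%:E)%E.
Proof.
move=> N0; apply: (volume_grid_cell_le (c := c) cube_coord_mx N0).
by rewrite -cubeE.
Qed.

Lemma unit_volume_side_le1 : (0 < n)%N -> s <= 1.
Proof.
move=> n0; apply: (eball_shrink_le1 n0 s0) => r e r0 e0.
exact: (volume_eball_shrink cube_coord_mx cube_coord_dotp volume_cube_cell).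
Qed.

(** The cells met by [A] cover it and have volume at most [N^-n] each, so there are at least
    [eps * N^n] of them. *)
Lemma volume_grid_large (eps : R) (A : set 'rV[R]_n) :
  A `<=` [set place x | x in unit_cube R n] -> volume A = eps%:E ->
  grid_large eps [set x | A (place x)].
Proof.
move=> AK vA N N0; have N0' : 0 < N%:R :> R by rewrite ltr0n.
exists [pred k : {ffun 'I_n -> 'I_N.+1} |
  `[< A `&` cell c P (grid_point 0 N%:R^-1 k) N%:R^-1 !=set0 >]]; split.
  have := @volume_le_hits R n N N.+1 0 c _ _ A cube_coord_mx N0 (volume_cube_cell N0).
  rewrite vA lee_fin -[_ *+ #|_|]mulr_natl ler_pdivlMr ?exprn_gt0//.
  apply=> y /AK; rewrite cubeE => yK i; have /andP[-> /=] := yK i.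
  by move/le_lt_trans; apply; rewrite add0r ltr_pdivlMr// mul1r ltr_nat.
move=> k /asboolP[y [Ay yk]]; exists ((y - c) *m P); first by rewrite /= cube_placeK.
move=> i; have := yk i; rewrite [grid_point _ _ _ _ _]mxE add0r.
by move=> /andP[-> /ltW ->].
Qed.

(** The close pair is found in the coordinates of the unit cube; [place] multiplies its distance by
    [s <= 1]. *)
Lemma set_dist_le (eps : R) (A B : set 'rV[R]_n) : (0 < n)%N -> 0 < eps ->
  A `<=` [set place x | x in unit_cube R n] ->
  B `<=` [set place x | x in unit_cube R n] ->
  @convex_set R 'rV[R]_n A -> @convex_set R 'rV[R]_n B ->
  volume A = eps%:E -> volume B = eps%:E ->
  set_dist A B <= Num.sqrt (64 / eps).
Proof.
move=> n0 e0 AK BK cA cB vA vB.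
have seg S : @convex_set R 'rV[R]_n S -> forall x y (t : R),
    S (place x) -> S (place y) -> 0 <= t <= 1 -> S (place (x + t *: (y - x))).
  move=> cS x y t Sx Sy t01; have := convex_set_segment cS Sx Sy t01.
  congr S; rewrite /place mulmxDl -scalemxAl mulmxBl.
  by move: (x *m Q) (y *m Q) => u v; apply/rowP => i; rewrite !mxE; ring.
have sub S : S `<=` [set place x | x in unit_cube R n] ->
    [set x | S (place x)] `<=` unit_cube R n.
  by move=> SK x /= /SK[y yK /(congr1 (fun z => (z - c) *m P))]; rewrite !cube_coordK => <-.
have [x [y [Ax By xy]]] := convex_sets_close e0 (seg _ cA) (seg _ cB)
  (sub _ AK) (sub _ BK) (volume_grid_large AK vA) (volume_grid_large BK vB).
apply: (@le_trans _ _ (enorm (place x - place y))).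
  apply: ge_inf; first by exists 0 => _ [a _ [b _ <-]]; exact: sqrtr_ge0.
  by exists (place x) => //; exists (place y).
have -> : place x - place y = s *: ((x - y) *m Q).
  by rewrite /place mulmxBl scalerBr opprD addrACA subrr add0r.
rewrite /enorm ler_sqrt ?divr_ge0 ?(ltW e0)// dotpZ dotp_orthogonal//.
apply: le_trans xy; rewrite ler_piMl ?dotp_ge0//.
by rewrite exprn_ile1// ?(ltW s0)// unit_volume_side_le1.
Qed.

End CubeCoordinates.

Theorem theorem2 (R : realType) :
  (forall (n : nat) (eps : R), (0 < n)%N -> 0 < eps < 2^-1 ->
     max_coords_equal n eps) ->
  forall eps : R, 0 < eps < 2^-1 ->
  exists d : R, forall n : nat, (0 < n)%N ->
  forall K A B : set 'rV[R]_n,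
    is_cube K -> volume K = 1%:E ->
    A `<=` K -> B `<=` K ->
    @convex_set R 'rV[R]_n A -> @convex_set R 'rV[R]_n B ->
    volume A = eps%:E -> volume B = eps%:E ->
    set_dist A B <= d.
Proof.
move=> _ eps /andP[e0 _]; exists (Num.sqrt (64 / eps)) => n n0 K A B.
move=> [c [s [Q [s0 QQ ->]]]] vK AK BK cA cB vA vB.
exact: (set_dist_le s0 QQ vK n0 e0 AK BK cA cB vA vB).
Qed.
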